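(* Let $n\geq 1$. For any conjugacy class $C$ in $SL(n+1, \mathbf{k})$, $m_C = m_{l(C)}$, i.e., $m_C = w_0$ if $r(C) \geq \left[\frac{n+1}{2}\right]$ and $m_C = m_{r(C)}$ if $r(C) < \left[\frac{n+1}{2}\right]$.
   Context: $\mathbf{k}$ is an algebraically closed field. $B$ is the subgroup of upper-triangular matrices in $SL(n+1,\mathbf{k})$ and $H$ the subgroup of diagonal matrices. The Weyl group $N_G(H)/H$ of $G = SL(n+1,\mathbf{k})$ is identified with the permutation group $S_{n+1}$ of $\{1,\dots,n+1\}$ (a representative $\dot w$ of $w$ is a monomial matrix whose nonzero entries are in positions $(w(i), i)$), and $BwB = B\dot{w}B$. $w_0$ is the longest element of $S_{n+1}$. For a conjugacy class $C$, $m_C$ is the unique element of $S_{n+1}$ such that $C\cap (Bm_CB)$ is dense in $C$ (it exists and is unique). For any $g \in C$, $r(C) = \min\{\operatorname{rank}(g - cI_{n+1}) : c \in \mathbf{k}\}$, where $I_{n+1}$ is the identity matrix, and $l(C) = \min\left\{r(C), \left[\frac{n+1}{2}\right]\right\}$, where $[x]$ is the largest integer $\leq x$. For integers $0 \leq l \leq \left[\frac{n+1}{2}\right]$, $m_l\in S_{n+1}$ is defined by $m_0 = 1$ and, for $l \geq 1$, by the cycle decomposition $m_l = (1, n+1)(2,n)\cdots(l, n+2-l)$; in particular $m_l = w_0$ for $l = \left[\frac{n+1}{2}\right]$. *)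

(* Defs.v *)
From HB Require Import structures.
From mathcomp Require Import all_boot all_order all_algebra all_fingroup.
From mathcomp Require Import boolp classical_sets.
From mathcomp Require Import mpoly.

Set Implicit Arguments.
Unset Strict Implicit.
Unset Printing Implicit Defensive.

Import GRing.Theory.
Local Open Scope ring_scope.
Local Open Scope classical_set_scope.

Section Zariski.
Variables (k : fieldType) (m : nat).

(* The affine space of m x m matrices carries the Zariski topology;
   [mxvec] lists the m * m entries, which serve as coordinates. *)
Definition entry_eval (p : {mpoly k[m * m]}) (g : 'M[k]_m) : k :=
  p.@[fun i => mxvec g 0 i].

Definition zariski_closed (Z : set 'M[k]_m) : Prop :=
  exists P : set {mpoly k[m * m]},
    Z = [set g | forall p, P p -> entry_eval p g = 0].

Definition zariski_closure (S : set 'M[k]_m) : set 'M[k]_m :=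
  [set g | forall Z, zariski_closed Z -> S `<=` Z -> Z g].

Definition zariski_dense_in (S C : set 'M[k]_m) : Prop :=
  S `<=` C /\ C `<=` zariski_closure S.

End Zariski.

Section SpecialLinear.
Variables (k : fieldType) (m : nat).

Definition SL : set 'M[k]_m := [set g | \det g = 1].

Definition SL_class_of (g : 'M[k]_m) : set 'M[k]_m :=
  [set x *m g *m invmx x | x in SL].

Definition SL_conjugacy_class (C : set 'M[k]_m) : Prop :=
  exists2 g, SL g & C = SL_class_of g.

(* Not [is_trig_mx], which is lower triangular. *)
Definition borel : set 'M[k]_m :=
  [set b | SL b /\ forall i j : 'I_m, (j < i)%N -> b i j = 0].

Definition weyl_repr (w : 'S_m) : set 'M[k]_m :=
  [set d | SL d /\ forall i j, (d i j != 0) = (i == w j)].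

(* Two representatives of w differ by a diagonal matrix of determinant 1, so
   letting d range over all of them gives the same double coset as fixing one. *)
Definition bruhat_cell (w : 'S_m) : set 'M[k]_m :=
  [set g | exists b1 d b2,
    [/\ borel b1, weyl_repr w d, borel b2 & g = b1 *m d *m b2]].

Definition is_m_of_class (C : set 'M[k]_m) : 'S_m -> Prop :=
  unique (fun w => zariski_dense_in (C `&` bruhat_cell w) C).

Lemma rank_shift_ex (g : 'M[k]_m) :
  exists r, `[< exists c : k, \rank (g - c%:M) = r >].
Proof. by exists (\rank (g - 0%:M)); apply/asboolP; exists 0. Qed.

(* The minimum over c of rank (g - c I). *)
Definition r_of (g : 'M[k]_m) : nat := ex_minn (rank_shift_ex g).

Definition l_of (g : 'M[k]_m) : nat := minn (r_of g) m./2.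

End SpecialLinear.

Section SymmetricGroup.
Variable m : nat.

(* Coxeter length: the number of inversions. *)
Definition perm_length (w : 'S_m) : nat :=
  #|[set ij : 'I_m * 'I_m | (ij.1 < ij.2)%N && (w ij.2 < w ij.1)%N]%SET|.

Definition w0 : 'S_m := [arg max_(w > 1%g) perm_length w].

(* Indices start at 0, so i + 1 <-> m - i becomes i <-> m - 1 - i = rev_ord i.
   The factors are disjoint transpositions when l <= m./2. *)
Definition m_perm (l : nat) : 'S_m :=
  (\prod_(i < m | (i < l)%N) tperm i (rev_ord i))%g.

End SymmetricGroup.

(* Main.v *)
Require Import Defs.
From mathcomp Require Import all_boot all_order all_algebra all_fingroup.
From mathcomp Require Import boolp classical_sets.
From mathcomp Require Import mpoly.
From mathcomp Require Import ring zify.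
Set Implicit Arguments.
Unset Strict Implicit.
Unset Printing Implicit Defensive.
Import GRing.Theory.
Local Open Scope ring_scope.

(** Write N = n + 1, let C be the class of g, l = l(C), r = r(C), and call
    p-corner of a matrix its lower left p x p block.

    The class C is irreducible: two points of C are conjugates of g by x0 and
    x1, and along the line from x0 to x1 every polynomial function on C is,
    up to a power of the determinant, a polynomial in one variable
    ([SL_class_irreducible]). So if finitely many polynomials are each nonzero
    somewhere on C, then their product H is nonzero somewhere on C, and the
    locus H <> 0 is dense in C. It therefore suffices to find such an H for
    which every h in C with H(h) <> 0 lies in B m_l B. Density of C inside any
    other cell BwB would give a point of BwB with H <> 0, contradicting the
    disjointness of Bruhat cells ([bruhat_cell_inj]).

    H is the product of the minors given by the p-corners of h and of h^-1 for
    p <= l ([generic_minors]). Two facts are needed.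

    - Each of these minors is nonzero somewhere on C. As r(g^-1) = r(g), it is
      enough to treat g. If Y is a space of p row vectors such that Y + Yg has
      dimension 2p, a basis of k^N beginning with a basis of Yg and ending with
      the corresponding basis of Y conjugates g to a matrix whose p-corner is
      the identity ([corner_conj_eq1]). Such a Y exists as soon as 2p <= N and
      every g - c has rank at least p ([general_position]).

    - If H(h) <> 0, write h = b1 d b2 in some cell BwB. The corners of h and
      h^-1 force w to exchange a and N - 1 - a for a < l ([bruhat_corners_rev]).
      If l = N/2 (rounded down) there is at most one index left and w = m_l.
      Otherwise l = r, and the rank of h - c is at least the number of indices
      a with a < w(a), for every c ([excedances_le_rank]); as the a < l already
      account for r of them, w(a) <= a on the remaining indices, so that w fixes
      them and w = m_l ([generic_minors_cell]). *)

(** * Subspaces in general position with their image *)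

Section GeneralPosition.
Variables (F : fieldType) (N : nat) (g : 'M[F]_N).

Lemma subrmx_sub m1 m2 (A B : 'M[F]_(m1, N)) (S : 'M_(m2, N)) :
  (A <= S)%MS -> (B <= S)%MS -> (A - B <= S)%MS.
Proof. by move=> AS BS; rewrite addmx_sub // eqmx_opp. Qed.

Lemma exists_notin_rowspace (S : 'M[F]_N) :
  (\rank S < N)%N -> exists v : 'rV[F]_N, ~~ (v <= S)%MS.
Proof.
move=> rS; have: ~~ (1%:M <= S)%MS.
  by apply/negP => /mxrankS; rewrite mxrank1 leqNgt rS.
by case/row_subPn=> i Hi; exists (row i 1%:M).
Qed.

(** Modulo a subspace of codimension at least two, this is the statement that a
    linear map for which every vector is an eigenvector is a homothety; that S is
    stable under g is part of the conclusion. *)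
Lemma scalar_mod_subspace (S : 'M[F]_N) :
  ((\rank S).+2 <= N)%N ->
  (forall v : 'rV_N, ~~ (v <= S)%MS -> (v *m g <= v + S)%MS) ->
  exists c, (g - c%:M <= S)%MS.
Proof.
move=> rS gS.
have eig (v : 'rV_N) : ~~ (v <= S)%MS ->
    exists c, (v *m g - c *: v <= S)%MS.
  move=> /gS /sub_addsmxP[[a b] /= ->]; exists (a 0 0).
  rewrite [a in a *m v]mx11_scalar mul_scalar_mx addrAC subrr add0r.
  exact: submxMl.
have eq_eig (u v : 'rV_N) a b : ~~ (u <= S)%MS -> ~~ (v <= u + S)%MS ->
    (u *m g - a *: u <= S)%MS -> (v *m g - b *: v <= S)%MS -> a = b.
  move=> uS vS Hu Hv.
  have uvS : ~~ ((u + v)%R <= S)%MS.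
    apply: contra vS => uvS; rewrite -[v](addKr u) addmx_sub //.
      by rewrite eqmx_opp addsmxSl.
    exact: submx_trans uvS (addsmxSr _ _).
  have [c Huv] := eig _ uvS.
  have Hc : (((a - c) *: u + (b - c) *: v)%R <= S)%MS.
    have -> : (a - c) *: u + (b - c) *: v =
      ((u + v) *m g - c *: (u + v)) - (u *m g - a *: u) - (v *m g - b *: v).
      rewrite mulmxDl; set x := u *m g; set y := v *m g.
      by apply/rowP => i; rewrite !mxE; ring.
    by do 2 apply: subrmx_sub => //.
  have bc : b = c.
    apply/eqP; rewrite -subr_eq0; apply: contraR vS => bc.
    have -> : v = (b - c)^-1 *: (((a - c) *: u + (b - c) *: v) - (a - c) *: u).
      by rewrite addrAC subrr add0r scalerA mulVf ?scale1r.
    apply/scalemx_sub/subrmx_sub; first exact: submx_trans Hc (addsmxSr _ _).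
    by rewrite scalemx_sub // addsmxSl.
  move: Hc; rewrite bc subrr scale0r addr0 => Hc.
  apply/eqP; rewrite -subr_eq0; apply: contraR uS => ac.
  by rewrite -(scale1r u) -(mulVf ac) -scalerA scalemx_sub.
(* Two vectors that are independent modulo S, against which all others compare. *)
have [u1 u1S] := exists_notin_rowspace (leq_trans (leqnSn _) rS).
have [c Hc] := eig _ u1S.
have rS1 : (\rank (u1 + S)%MS < N)%N.
  apply: leq_ltn_trans (mxrank_adds_leqif _ _) _.
  by apply: leq_trans rS; rewrite ltnS -[X in (_ <= X)%N]add1n leq_add2r rank_leq_row.
have [u2 u2S] := exists_notin_rowspace rS1.
have out (v : 'rV_N) : ~~ (v <= u1 + S)%MS -> (v *m g - c *: v <= S)%MS.
  move=> vS; have vS' : ~~ (v <= S)%MS.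
    by apply: contra vS => /submx_trans->//; rewrite addsmxSr.
  by have [b Hb] := eig _ vS'; rewrite (eq_eig _ _ _ _ u1S vS Hc Hb).
have all_v (v : 'rV_N) : (v *m g - c *: v <= S)%MS.
  have [vS|/out//] := boolP (v <= u1 + S)%MS.
  have /out H : ~~ ((u2 + v)%R <= u1 + S)%MS.
    by apply: contra u2S => H; rewrite -[u2](addrK v) subrmx_sub.
  have -> : v *m g - c *: v
     = ((u2 + v) *m g - c *: (u2 + v)) - (u2 *m g - c *: u2).
    rewrite mulmxDl; set x := u2 *m g; set y := v *m g.
    by apply/rowP => i; rewrite !mxE; ring.
  by apply: subrmx_sub => //; apply: out.
exists c; apply/row_subP => i.
by rewrite rowE mulmxBr mul_mx_scalar all_v.
Qed.

Lemma mxrank_add_row m (v : 'rV[F]_N) (S : 'M[F]_(m, N)) :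
  ~~ (v <= S)%MS -> \rank (v + S)%MS = (\rank S).+1.
Proof.
move=> vS; apply/eqP; rewrite eqn_leq; apply/andP; split.
  apply: leq_trans (mxrank_adds_leqif _ _) _.
  by rewrite -[X in (_ <= X)%N]add1n leq_add2r rank_leq_row.
apply: rank_ltmx; rewrite ltmxE addsmxSr /=.
by apply: contra vS => /(submx_trans _)->//; rewrite addsmxSl.
Qed.

Lemma mxrank_adds_image (Z : 'M[F]_N) :
  (\rank (Z + Z *m g)%MS <= (\rank Z).*2)%N.
Proof.
apply: leq_trans (mxrank_adds_leqif _ _) _.
by rewrite -addnn leq_add2l mxrankM_maxl.
Qed.

(** Induction on p. If Y of dimension p cannot be enlarged, every vector outside
    S = Y + Yg is an eigenvector of g modulo S, so the image of some A = g - c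
    lies in S, by [scalar_mod_subspace]. As A has rank more than p, some nonzero
    v0 in Y lies in the image of A. Replacing v0 by v0 + z' in Y, for a suitable
    z' outside S, gives a space W of the same kind for which T = W + Wg does not
    contain v0; but T must contain the image of some g - c' by the same argument.
    If c' = c, then T contains v0; otherwise S + T is the whole space, although
    its dimension is at most 2p + 1 < N. *)
Lemma general_position p :
  (forall c, (p <= \rank (g - c%:M)%R)%N) -> (p.*2 <= N)%N ->
  exists Y : 'M[F]_N, (\rank Y <= p)%N /\ (p.*2 <= \rank (Y + Y *m g)%MS)%N.
Proof.
elim: p => [|p IHp] rg pN; first by exists 0; rewrite mxrank0.
have [||Y [rY rYg]] := IHp.
- by move=> c; apply: leq_trans (rg c).
- by apply: leq_trans pN; rewrite leq_double.
have [//|noY] := EM (exists Y : 'M[F]_N,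
  (\rank Y <= p.+1)%N /\ (p.+1.*2 <= \rank (Y + Y *m g)%MS)%N).
have maxp (Z : 'M[F]_N) : (\rank Z <= p)%N ->
    (p.*2 <= \rank (Z + Z *m g)%MS)%N ->
    exists c, (g - c%:M <= Z + Z *m g)%MS.
  move=> rZ rZg; apply: scalar_mod_subspace.
    apply: leq_trans pN; rewrite !ltnS.
    by rewrite (leq_trans (mxrank_adds_image Z)) ?leq_double.
  move=> v vS; apply: contrapT => /negP vgS; apply: noY; exists (v + Z)%MS; split.
    rewrite (leq_trans (mxrank_adds_leqif _ _)) // -[X in (_ <= X)%N]add1n.
    by rewrite leq_add ?rank_leq_row.
  have sub : (v *m g + (v + (Z + Z *m g)) <=
              (v + Z) + (v + Z)%MS *m g)%MS.
    rewrite !addsmx_sub; apply/and4P; split.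
    - exact: submx_trans (submxMr _ (addsmxSl _ _)) (addsmxSr _ _).
    - exact: submx_trans (addsmxSl _ _) (addsmxSl _ _).
    - exact: submx_trans (addsmxSr _ _) (addsmxSl _ _).
    - exact: submx_trans (submxMr _ (addsmxSr _ _)) (addsmxSr _ _).
  by apply: leq_trans (mxrankS sub); rewrite !mxrank_add_row.
have [c] := maxp Y rY rYg; set A := g - c%:M => AS.
set S := (Y + Y *m g)%MS in rYg AS.
have mulA m (M : 'M[F]_(m, N)) : M *m A = M *m g - c *: M.
  by rewrite mulmxBr mul_mx_scalar.
have mulg m (M : 'M[F]_(m, N)) : M *m g = M *m A + c *: M by rewrite mulA subrK.
have rS : \rank S = p.*2.
  apply/eqP; rewrite eqn_leq rYg andbT.
  by rewrite (leq_trans (mxrank_adds_image Y)) ?leq_double.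
have [i rowA] : exists i, ~~ (row i A <= Y *m A)%MS.
  apply/row_subPn; apply/negP => /mxrankS; apply/negP; rewrite -ltnNge.
  by apply: leq_trans (rg c); rewrite ltnS (leq_trans (mxrankM_maxl _ _)).
have SA : (S <= Y + Y *m A)%MS.
  rewrite addsmx_sub addsmxSl mulg /= addmx_sub ?addsmxSr //.
  by rewrite scalemx_sub ?addsmxSl.
have /sub_addsmxP[[a1 a2] /= rowAE] : (row i A <= Y + Y *m A)%MS.
  exact: submx_trans (row_sub _ _) (submx_trans AS SA).
pose v0 := a1 *m Y.
have v0Y : (v0 <= Y)%MS by apply: submxMl.
have v0A : (v0 <= A)%MS.
  have -> : v0 = row i A - a2 *m (Y *m A) by rewrite rowAE addrK.
  by apply: subrmx_sub; [apply: row_sub | rewrite mulmxA submxMl].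
have v0n0 : v0 != 0.
  by apply: contra rowA => /eqP v00; rewrite rowAE [a1 *m Y]v00 add0r submxMl.
pose V1 := (Y :\: v0)%MS.
have V1Y : (V1 <= Y)%MS by apply: diffmxSl.
have YV : (Y <= v0 + V1)%MS.
  rewrite -(addsmx_diff_cap_eq Y v0) addsmxC; apply: addsmxS => //.
  exact: capmxSr.
have rV1 : ((\rank V1).+1 <= p)%N.
  apply: leq_trans rY; rewrite -(mxrank_cap_compl Y v0) -/V1.
  have -> : \rank (Y :&: v0)%MS = 1%N.
    by rewrite (capmx_idPr v0Y) rank_rV v0n0.
  by [].
have SA' : (S <= v0 *m A + (Y + V1 *m A))%MS.
  apply: submx_trans SA _; rewrite addsmx_sub; apply/andP; split.
    exact: submx_trans (addsmxSl _ _) (addsmxSr _ _).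
  apply: submx_trans (submxMr _ YV) _; rewrite addsmxMr addsmxS //.
  exact: addsmxSr.
have [|z zS] := @exists_notin_rowspace S.
  by rewrite rS; apply: leq_trans pN; rewrite doubleS leqW.
have /sub_addsmxP[[b1 b2] /= zAE] : (z *m A <= v0 *m A + (Y + V1 *m A))%MS.
  exact: submx_trans (submxMl _ _) (submx_trans AS SA').
(* Subtracting the v0-component brings the image of z into Y + V1 A, a hyperplane
   of S that does not contain v0 A. *)
pose z' := z - b1 *m v0.
have z'A : (z' *m A <= Y + V1 *m A)%MS.
  by rewrite mulmxBl zAE -[b1 *m v0 *m A]mulmxA addrAC subrr add0r submxMl.
have YS : (Y <= S)%MS by apply: addsmxSl.
have z'S : ~~ (z' <= S)%MS.
  apply: contra zS => z'S; rewrite -[z](subrK (b1 *m v0)) addmx_sub //.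
  exact: submx_trans (submxMl _ _) (submx_trans v0Y YS).
pose W := ((v0 + z')%R + V1)%MS; pose T := (W + W *m g)%MS.
have rW : (\rank W <= p)%N.
  by apply: leq_trans rV1; rewrite (leq_trans (mxrank_adds_leqif _ _)) //
     -[X in (_ <= X)%N]add1n leq_add2r rank_leq_row.
have WT : (W <= T)%MS by apply: addsmxSl.
have WAT : (W *m A <= T)%MS.
  by rewrite mulA; apply: subrmx_sub; rewrite ?addsmxSr // scalemx_sub.
have yW : ((v0 + z')%R <= W)%MS by apply: addsmxSl.
have V1W : (V1 <= W)%MS by apply: addsmxSr.
have z'ST : (z' + S <= v0 + T)%MS.
  have z'T : (z' <= v0 + T)%MS.
    rewrite -[z'](addKr v0) addrC subrmx_sub ?addsmxSl //.
    exact: submx_trans yW (submx_trans WT (addsmxSr _ _)).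
  have YT : (Y <= v0 + T)%MS.
    by apply: submx_trans YV (addsmxS _ _) => //; apply: submx_trans V1W WT.
  have YVT : (Y + V1 *m A <= v0 + T)%MS.
    rewrite addsmx_sub YT /= (submx_trans _ (addsmxSr _ _)) //.
    exact: submx_trans (submxMr _ V1W) WAT.
  rewrite addsmx_sub z'T /= (submx_trans SA') // addsmx_sub YVT andbT.
  have -> : v0 *m A = (v0 + z') *m A - z' *m A by rewrite mulmxDl addrK.
  apply: subrmx_sub; last exact: submx_trans z'A YVT.
  exact: submx_trans (submxMr _ yW) (submx_trans WAT (addsmxSr _ _)).
have rT : (p.*2.+1 <= \rank (v0 + T)%MS)%N.
  by apply: leq_trans (mxrankS z'ST); rewrite mxrank_add_row ?rS.
have v0T : ~~ (v0 <= T)%MS.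
  apply: contraL rT => /addsmx_idPr->.
  by rewrite -leqNgt (leq_trans (mxrank_adds_image W)) ?leq_double.
have [|c' gT] := maxp W rW; first by move: rT; rewrite mxrank_add_row.
have [cc'|cc'] := eqVneq c c'.
  by case/negP: v0T; apply: submx_trans v0A _; rewrite /A cc'.
have one_sub : (1%:M <= z' + S)%MS.
  have TS : (T <= z' + S)%MS.
    have WS : (W <= z' + S)%MS.
      rewrite addsmx_sub; apply/andP; split.
        rewrite addmx_sub ?addsmxSl //.
        exact: submx_trans v0Y (submx_trans YS (addsmxSr _ _)).
      exact: submx_trans V1Y (submx_trans YS (addsmxSr _ _)).
    rewrite addsmx_sub WS mulg /= addmx_sub ?scalemx_sub //.
    exact: submx_trans (submxMl _ _) (submx_trans AS (addsmxSr _ _)).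
  have AB : A - (g - c'%:M) = (c' - c)%:M.
    by rewrite /A opprB addrC addrA subrK -raddfB.
  have -> : 1%:M = (c' - c)^-1 *: (A - (g - c'%:M)).
    by rewrite AB scale_scalar_mx mulVf // subr_eq0 eq_sym.
  apply/scalemx_sub/subrmx_sub; first exact: submx_trans AS (addsmxSr _ _).
  exact: submx_trans gT TS.
have := mxrankS one_sub; rewrite mxrank1 mxrank_add_row // rS.
by rewrite leqNgt; move: pN; rewrite doubleS => ->.
Qed.
End GeneralPosition.

(** * Conjugates with invertible corners *)

Section CornerPoint.
Variables (n p : nat).

(** [inord] keeps these total; they are the last and the first p indices only when
    p <= n.+1, which the lemmas assume. *)
Definition low_index (i : 'I_p) : 'I_n.+1 := inord (n.+1 - p + i).
Definition left_index (j : 'I_p) : 'I_n.+1 := inord j.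

Definition corner (R : Type) (h : 'M[R]_n.+1) : 'M[R]_p :=
  mxsub low_index left_index h.

Lemma low_indexE (i : 'I_p) : (p <= n.+1)%N -> low_index i = (n.+1 - p + i)%N :> nat.
Proof.
by move=> pn; rewrite inordK // -{2}(subnK pn) ltn_add2l.
Qed.

Lemma left_indexE (j : 'I_p) : (p <= n.+1)%N -> left_index j = j :> nat.
Proof. by move=> pn; rewrite inordK // (leq_trans (ltn_ord j)). Qed.

Variable F : fieldType.

(** The matrix x has the rows of Y g on top and those of Y at the bottom. Hence the
    last p rows of x g are the first p rows of x, and multiplying them by x^-1 gives
    rows of the identity. *)
Lemma corner_conj_eq1 (g : 'M[F]_n.+1) (Y : 'M[F]_(p, n.+1)) :
  (p.*2 <= n.+1)%N -> row_free (col_mx (Y *m g) Y) ->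
  exists2 x, x \in unitmx & corner (x *m g *m invmx x) = 1%:M.
Proof.
move=> pn; set E := col_mx _ _ => freeE.
have pn1 : (p <= n.+1)%N by apply: leq_trans pn; rewrite -addnn leq_addr.
pose f (k : 'I_(p + p)) : 'I_n.+1 :=
  match split k with inl j => left_index j | inr i => low_index i end.
have f_inj : injective f.
  have disj (i j : 'I_p) : left_index j != low_index i.
    rewrite -val_eqE /= left_indexE // low_indexE //.
    rewrite neq_ltn (leq_trans (ltn_ord j)) // -(leq_add2r p).
    by rewrite addnAC subnK // addnn (leq_trans pn) ?leq_addr.
  move=> k l; rewrite /f; case: splitP => i Hi; case: splitP => j Hj.
  - move=> /(congr1 val) /=; rewrite !left_indexE // => ij.
    by apply: val_inj; rewrite /= Hi Hj.
  - by move=> eq; case/eqP: (disj j i).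
  - by move=> eq; case/eqP: (disj i j).
  - move=> /(congr1 val) /=; rewrite !low_indexE // => /addnI ij.
    by apply: val_inj; rewrite /= Hi Hj ij.
pose U : 'M[F]_(p + p, n.+1) := rowsub f 1%:M.
have UM m (M : 'M[F]_(n.+1, m)) : U *m M = rowsub f M.
  by rewrite mul_rowsub_mx mul1mx.
have UUT : U *m U^T = 1%:M.
  by apply/matrixP => i j; rewrite UM !mxE (inj_eq f_inj) eq_sym.
have [|x xu] := @complete_unitmx F _ _ U (U^T *m E).
  have /eqP-> : row_free U by apply/row_freeP; exists U^T.
  by rewrite mulmxA UUT mul1mx; apply/eqP.
rewrite mulmxA UUT mul1mx UM => EE; exists x => //.
have lowE : rowsub low_index x = Y.
  apply/matrixP => i j; have := congr1 (fun M : 'M_(_, _) => M (rshift p i) j) EE.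
  by rewrite /E col_mxEd => ->; rewrite !mxE /f (unsplitK (inr i)).
have leftE : rowsub left_index x = Y *m g.
  apply/matrixP => i j; have := congr1 (fun M : 'M_(_, _) => M (lshift p i) j) EE.
  by rewrite /E col_mxEu => ->; rewrite !mxE /f (unsplitK (inl i)).
rewrite /corner mxsub_mul -mul_rowsub_mx lowE -leftE -mxsub_mul mulmxV //.
apply/matrixP => i j; rewrite !mxE.
by rewrite -val_eqE /= !left_indexE.
Qed.

Lemma exists_corner_unit (g : 'M[F]_n.+1) :
  (p.*2 <= n.+1)%N -> (forall c, (p <= \rank (g - c%:M)%R)%N) ->
  exists2 x, x \in unitmx & corner (x *m g *m invmx x) = 1%:M.
Proof.
move=> pn rg; have [Y [rY rYg]] := general_position rg pn.
have eY : \rank Y = p.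
  apply/eqP; rewrite eqn_leq rY -leq_double.
  exact: leq_trans rYg (mxrank_adds_image g Y).
have [Z eZ] : exists Z : 'M[F]_(p, n.+1), (Z :=: Y)%MS.
  by move: (row_base Y) (eq_row_base Y); rewrite eY => Z; exists Z.
apply: (@corner_conj_eq1 g Z) => //; rewrite -row_leq_rank -addsmxE addnn.
apply: leq_trans rYg _; rewrite addsmxC mxrankS //.
by apply: addsmxS; rewrite ?eZ // submxMr ?eZ.
Qed.

End CornerPoint.

(** * Bruhat cells *)

Section UpperTriangular.
Variables (F : fieldType) (m : nat).
Implicit Types b x : 'M[F]_m.

Definition upper b := forall i j : 'I_m, (j < i)%N -> b i j = 0.

Lemma upper_mul b x : upper b -> upper x -> upper (b *m x).
Proof.
move=> ub ux i j ji; rewrite mxE big1 // => k _.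
have [ki|ik] := ltnP k i; first by rewrite ub // mul0r.
by rewrite (ux k) ?mulr0 // (leq_trans ji).
Qed.

Lemma upper_det b : upper b -> \det b = \prod_i b i i.
Proof.
move=> ub; rewrite -det_tr det_trig; first by apply: eq_bigr => i _; rewrite mxE.
by apply/is_trig_mxP => i j ij; rewrite mxE ub.
Qed.

Lemma upper_diag_neq0 b : upper b -> \det b = 1 -> forall i, b i i != 0.
Proof.
move=> ub; rewrite upper_det // => b1 i; apply: contraTneq (oner_neq0 F) => bi0.
by rewrite -b1 (bigD1 i) //= bi0 mul0r eqxx.
Qed.

Lemma upper_cancel b x :
  upper b -> (forall i, b i i != 0) -> upper (b *m x) -> upper x.
Proof.
move=> ub b0 ubx.
(* Back substitution, from the last row upwards. *)
suff H k : forall i j : 'I_m, (m - i <= k)%N -> (j < i)%N -> x i j = 0.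
  by move=> i j; apply: (H m); rewrite leq_subr.
elim: k => [|k IHk] i j.
  by rewrite leqn0 subn_eq0 leqNgt ltn_ord.
move=> ik ji; have := ubx i j ji; rewrite mxE (bigD1 i) //= big1 ?addr0 => [|l li].
  by move/eqP; rewrite mulf_eq0 (negPf (b0 i)) => /eqP.
have [il|li'] := ltnP i l; last by rewrite ub ?mul0r // ltn_neqAle li' andbT.
rewrite IHk ?mulr0 ?(ltn_trans ji) // -ltnS (leq_trans _ ik) //.
by rewrite ltn_sub2l.
Qed.

End UpperTriangular.

Section BruhatCells.
Variables (F : fieldType) (m : nat).
Implicit Types (b d h : 'M[F]_m) (w : 'S_m).

Lemma SL_unit h : SL h -> h \in unitmx.
Proof. by rewrite /SL /= unitmxE => ->; rewrite unitr1. Qed.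

Lemma SL_inv h : SL h -> SL (invmx h).
Proof. by rewrite /SL /= det_inv => ->; rewrite invr1. Qed.

Lemma SL_mul h h' : SL h -> SL h' -> SL (h *m h').
Proof. by rewrite /SL /= det_mulmx => -> ->; rewrite mulr1. Qed.

Lemma borel_inv b : borel b -> borel (invmx b).
Proof.
move=> [b1 ub]; split; first exact: SL_inv.
apply: (upper_cancel ub); first exact: upper_diag_neq0.
by rewrite mulmxV ?SL_unit // => i j ji; rewrite mxE -val_eqE gtn_eqF.
Qed.

Lemma borel_mul b b' : borel b -> borel b' -> borel (b *m b').
Proof. by move=> [b1 ub] [b1' ub']; split; [apply: SL_mul | apply: upper_mul]. Qed.

Lemma weyl_mulE w d b i j : weyl_repr w d -> (b *m d) i j = b i (w j) * d (w j) j.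
Proof.
move=> [_ dw]; rewrite mxE (bigD1 (w j)) //= big1 ?addr0 // => k kw.
by apply/eqP; rewrite mulf_eq0 -(negbK (d k j == 0)) dw (negPf kw) orbT.
Qed.

Lemma weyl_repr_neq0 w d j : weyl_repr w d -> d (w j) j != 0.
Proof. by move=> [_ ->]. Qed.

Lemma weyl_repr_inv w d : weyl_repr w d -> weyl_repr w^-1%g (invmx d).
Proof.
move=> dw; have [d1 _] := dw; split; first exact: SL_inv.
move=> i j; have := @weyl_mulE w d (invmx d) i (w^-1%g j) dw.
rewrite mulVmx ?SL_unit // permKV mxE; have := weyl_repr_neq0 (w^-1%g j) dw.
rewrite permKV; case: (eqVneq i (w^-1%g j)) => _ d0; last first.
  by move/esym/eqP; rewrite mulf_eq0 (negPf d0) orbF => ->.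
by apply: contra_eq_neq => ->; rewrite mul0r oner_neq0.
Qed.

Lemma bruhat_cell_inv w h : bruhat_cell w h -> bruhat_cell w^-1%g (invmx h).
Proof.
move=> [b1 [d [b2 [B1 dw B2 ->]]]]; exists (invmx b2), (invmx d), (invmx b1).
have [/SL_unit u1 _] := B1; have [/SL_unit u2 _] := B2; have [/SL_unit ud _] := dw.
split; [exact: borel_inv | exact: weyl_repr_inv | exact: borel_inv |].
have ubd : b1 *m d *m b2 \in unitmx by rewrite !unitmx_mul u1 ud u2.
apply: (can_inj (mulKmx ubd)); rewrite mulmxV // !mulmxA mulmxK // mulmxK //.
by rewrite mulmxV.
Qed.

Lemma perm_le_id w : (forall j, w j <= j)%N -> w = 1%g.
Proof.
move=> wj; suff H k : forall j : 'I_m, (j < k)%N -> w j = j.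
  by apply/permP => j; rewrite perm1 (H j.+1).
elim: k => // k IHk j; rewrite ltnS => jk; apply/eqP; apply: contraT => wjj.
have ltj : (w j < j)%N by rewrite ltn_neqAle wj andbT.
by have /perm_inj/eqP := IHk (w j) (leq_trans ltj jk); rewrite (negPf wjj).
Qed.

(** If b d = d' b' with b, b' upper triangular, the nonzero entry of b d at (w j, j)
    sits at row w'^-1 (w j) of b', so w'^-1 (w j) <= j for all j, and a permutation
    that never increases is trivial. *)
Lemma bruhat_cell_inj w w' h : bruhat_cell w h -> bruhat_cell w' h -> w = w'.
Proof.
move=> [b1 [d [b2 [B1 dw B2 ->]]]] [b1' [d' [b2' [B1' dw' B2' E]]]].
have [/SL_unit u1 _] := B1'; have [/SL_unit u2 _] := B2.
have [bS bU] := borel_mul (borel_inv B1') B1.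
have [_ bU'] := borel_mul B2' (borel_inv B2).
set b := invmx b1' *m b1 in bS bU; set b' := b2' *m invmx b2 in bU'.
have bd : b *m d = d' *m b'.
  apply: (can_inj (mulKmx u1)); rewrite /b !mulmxA mulmxV // mul1mx.
  by apply: (can_inj (mulmxK u2)); rewrite /= E mulmxKV.
suff : (w * w'^-1)%g = 1%g by move/eqP; rewrite -eq_mulgV1 => /eqP.
apply: perm_le_id => j; rewrite permM leqNgt; apply/negP => jw.
have := weyl_mulE b (w j) j dw; rewrite bd mxE big1 => [/esym/eqP|k _].
  by rewrite mulf_eq0 (negPf (weyl_repr_neq0 j dw)) (negPf (upper_diag_neq0 bU bS _)).
have [_ dw'E] := dw'.
have [->|kw] := eqVneq k (w'^-1%g (w j)); first by rewrite bU' ?mulr0.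
apply/eqP; rewrite mulf_eq0 -(negbK (d' _ _ == 0)) dw'E.
by rewrite -(inj_eq (@perm_inj _ w'^-1%g)) permK eq_sym (negPf kw).
Qed.

End BruhatCells.

(** * Existence of the Bruhat decomposition *)

Section BruhatDecomposition.
Variable F : fieldType.

(** Inverse of the deletion of row i and column j: the elimination rebuilds its three
    factors from those of a Schur complement in this way. *)
Definition bordered m (i j : 'I_m.+1) (c : F) (u v : 'I_m -> F) (M : 'M[F]_m) :=
  \matrix_(a, b) match unlift i a, unlift j b with
                 | None, None => c
                 | Some a', None => u a'
                 | None, Some b' => v b'
                 | Some a', Some b' => M a' b'
                 end.

Definition unitriangular m (U : 'M[F]_m) := upper U /\ forall i, U i i = 1.

Lemma unitriangular_borel m (U : 'M[F]_m) : unitriangular U -> borel U.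
Proof.
by move=> [uU U1]; split=> //; rewrite /SL /= upper_det // big1.
Qed.

Lemma bordered_unitriangular m (i : 'I_m.+1) u v (M : 'M[F]_m) :
  (forall a, (i < lift i a)%N -> u a = 0) ->
  (forall b, (lift i b < i)%N -> v b = 0) ->
  unitriangular M -> unitriangular (bordered i i 1 u v M).
Proof.
move=> u0 v0 [uM M1]; split=> [a b|a]; rewrite mxE.
  case: unliftP => [a' ->|->]; case: unliftP => [b' ->|->].
  - by rewrite ltnNge leq_bump2 -ltnNge => /uM.
  - exact: u0.
  - exact: v0.
  - by rewrite ltnn.
by case: unliftP.
Qed.

(** Gaussian elimination with as pivot the lowest nonzero entry of the first column:
    clearing the rest of the pivot column then adds the pivot row only to rows above it,
    and clearing the pivot row adds the first column only to columns on its right. Both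
    are unitriangular operations, and the matrix left after removing the pivot row and
    column is treated by induction. *)
Lemma unitriangular_bruhat m (A : 'M[F]_m) : A \in unitmx ->
  exists (w : 'S_m) (U D V : 'M[F]_m),
    [/\ unitriangular U, unitriangular V,
        forall i j, (D i j != 0) = (i == w j) & A = U *m D *m V].
Proof.
elim: m A => [|m IHm] A uA.
  exists 1%g, 0, 0, 0; split; try by [case | move=> ? [] | split=> [[]|[]]].
  by apply/matrixP => - [].
have [i0 Ai0] : exists i, A i 0 != 0.
  apply/existsP; apply: contraTT uA => /existsPn A0.
  rewrite unitmxE unitfE negbK -det_tr; apply/eqP.
  apply/eqP; apply/det0P; exists (delta_mx 0 0).
    by apply/eqP => /rowP/(_ 0); rewrite !mxE eqxx => /eqP; rewrite oner_eq0.
  apply/rowP => j; rewrite -rowE !mxE; apply/eqP.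
  by rewrite -[_ == _]negbK A0.
have [i Ai Amax] := @arg_maxnP _ i0 (fun i => A i 0 != 0) (fun i => val i) Ai0.
have A0 (a : 'I_m.+1) : (i < a)%N -> A a 0 = 0.
  by move=> ia; apply/eqP; apply: contraTT ia => /Amax /=; rewrite -leqNgt.
set al := A i 0 in Ai.
pose M : 'M[F]_m :=
  \matrix_(a, b) (A (lift i a) (lift 0 b) - A (lift i a) 0 * A i (lift 0 b) / al).
(* M is a Schur complement: a row relation between its rows extends to A. *)
have uM : M \in unitmx.
  rewrite -row_free_unit -kermx_eq0; apply/rowV0P => v /sub_kermxP vM.
  pose s := \sum_a v 0 a * A (lift i a) 0.
  pose u : 'rV[F]_m.+1 :=
    \row_a (if unlift i a is Some a' then v 0 a' else - (s / al)).
  have uA0 : u *m A = 0.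
    apply/rowP => b; rewrite !mxE (bigD1_ord i) //= !mxE unlift_none.
    under eq_bigr => a _ do rewrite mxE liftK.
    case: (unliftP 0 b) => [b' ->|->]; last by rewrite mulNr divfK ?addNr.
    have /eqP : (v *m M) 0 b' = 0 by rewrite vM mxE.
    rewrite mxE (eq_bigr (fun a => v 0 a * A (lift i a) (lift 0 b') -
      v 0 a * (A (lift i a) 0 * A i (lift 0 b') / al))) => [|a _]; last first.
      by rewrite mxE mulrBr.
    rewrite sumrB subr_eq0 => /eqP->.
    rewrite mulNr addrC; apply/eqP; rewrite subr_eq0; apply/eqP.
    by rewrite /s mulrAC !mulr_suml; apply: eq_bigr => a _; rewrite !mulrA.
  have u0 : u = 0 by rewrite -[u](mulmxK uA) uA0 mul0mx.
  apply/rowP => a; have := congr1 (fun M : 'rV_ _ => M 0 (lift i a)) u0.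
  by rewrite !mxE liftK.
have [w' [U' [D' [V' [U1 V1 D1 ME]]]]] := IHm M uM.
exists (lift_perm 0 i w').
exists (bordered i i 1 (fun a => A (lift i a) 0 / al) (fun=> 0) U').
exists (bordered i 0 al (fun=> 0) (fun=> 0) D').
exists (bordered 0 0 1 (fun=> 0) (fun b => A i (lift 0 b) / al) V').
split.
- by apply: bordered_unitriangular => // a ia; rewrite A0 ?mul0r.
- exact: bordered_unitriangular.
- move=> a b; rewrite mxE; case: (unliftP 0 b) => [b' ->|->].
    rewrite lift_perm_lift; case: unliftP => [a' ->|->].
      by rewrite D1 (inj_eq lift_inj).
    by rewrite eqxx (negPf (neq_lift _ _)).
  rewrite lift_perm_id; case: unliftP => [a' ->|->]; last by rewrite Ai eqxx.
  by rewrite eqxx eq_sym (negPf (neq_lift _ _)).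
apply/matrixP => a b; rewrite -mulmxA mxE (bigD1_ord i) //=.
have DV0 : (bordered i 0 al (fun=> 0) (fun=> 0) D' *m
  bordered 0 0 1 (fun=> 0) (fun b => A i (lift 0 b) / al) V') i b = A i b.
  rewrite mxE (bigD1_ord 0) //= big1 => [|k _].
    rewrite !mxE !unlift_none; case: unliftP => [b' ->|->]; rewrite addr0.
      by rewrite mulrC divfK.
    by rewrite mulr1.
  by rewrite !mxE unlift_none liftK mul0r.
have DV1 k : (bordered i 0 al (fun=> 0) (fun=> 0) D' *m
  bordered 0 0 1 (fun=> 0) (fun b => A i (lift 0 b) / al) V') (lift i k) b =
  if unlift 0 b is Some b' then (D' *m V') k b' else 0.
  rewrite mxE (bigD1_ord 0) //= !mxE unlift_none liftK mul0r add0r.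
  case: unliftP => [b' ->|->].
    by rewrite mxE; apply: eq_bigr => l _; rewrite !mxE !liftK.
  by rewrite big1 // => l _; rewrite !mxE !liftK unlift_none mulr0.
rewrite DV0; under eq_bigr => k _ do rewrite DV1 mxE liftK.
rewrite mxE unlift_none; case: unliftP => [a' ->|->]; last first.
  by rewrite mul1r big1 ?addr0 // => k _; rewrite mul0r.
case: unliftP => [b' ->|->]; last first.
  by rewrite big1 ?addr0 ?divfK // => k _; rewrite mulr0.
have := congr1 (fun M : 'M_m => M a' b') ME; rewrite -mulmxA !mxE => <-.
by rewrite mulrAC addrC subrK.
Qed.

Lemma SL_bruhat_cell m (h : 'M[F]_m) : SL h -> exists w, bruhat_cell w h.
Proof.
move=> hS; have [w [U [D [V [U1 V1 DE hE]]]]] := unitriangular_bruhat (SL_unit hS).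
have BU := unitriangular_borel U1; have BV := unitriangular_borel V1.
exists w, U, D, V; split => //; split => //.
move: hS; rewrite hE /SL /= !det_mulmx.
by case: BU => -> _; case: BV => -> _; rewrite mul1r mulr1.
Qed.

End BruhatDecomposition.

(** * Reading the cell from corners and ranks *)

Section CellDetection.
Variables (F : fieldType) (n : nat).
Implicit Types (h : 'M[F]_n.+1) (w : 'S_n.+1).

(** A vanishing corner minor means that some nonzero vector supported on the first p
    coordinates is mapped by h into the span of the first N - p. If w j < N - p for
    some j < p, the j-th column of b2^-1 is such a vector, since h sends it to a
    multiple of column w j of b1. *)
Lemma bruhat_corner p w h : (p <= n.+1)%N ->
  bruhat_cell w h -> \det (corner p h) != 0 ->
  forall j : 'I_n.+1, (j < p)%N -> (n.+1 - p <= w j)%N.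
Proof.
move=> pn [b1 [d [b2 [B1 dw B2 hE]]]] det0 j jp; rewrite leqNgt; apply/negP => wj.
have [b2S b2U] := borel_inv B2; have [_ b1U] := B1.
set c := invmx b2 in b2S b2U.
have hc : h *m c = b1 *m d.
  by rewrite hE mulmxK //; case: B2 => /SL_unit.
pose u : 'cV[F]_p := \col_a c (left_index n a) j.
have left_widen a : left_index n a = widen_ord pn a.
  by apply: val_inj; rewrite /= left_indexE.
have u0 : corner p h *m u = 0.
  apply/colP => i; rewrite !mxE.
  transitivity ((h *m c) (low_index n i) j).
    rewrite mxE [RHS](bigID (fun a : 'I_n.+1 => (a < p)%N)) /=.
    rewrite [X in _ + X]big1 => [|a ap].
      rewrite addr0 (big_ord_narrow pn); apply: eq_bigr => a _.
      by rewrite !mxE left_widen.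
    by rewrite b2U ?mulr0 //; apply: leq_trans jp _; rewrite leqNgt.
  rewrite hc (weyl_mulE _ _ _ dw) b1U ?mul0r // low_indexE //.
  by rewrite (leq_trans wj) ?leq_addr.
have cu : corner p h \in unitmx by rewrite unitmxE unitfE.
have /colP/(_ (Ordinal jp)) : u = 0 by rewrite -[u](mulKmx cu) u0 mulmx0.
rewrite !mxE (_ : left_index n (Ordinal jp) = j); last first.
  by apply: val_inj; rewrite /= left_indexE.
by apply/eqP; apply: upper_diag_neq0.
Qed.

(** The corners of sizes 1, 2, ..., l determine w 0, w 1, ..., w (l - 1) in turn: at each
    step w a lies among the last a + 1 indices, of which a are already taken. *)
Lemma bruhat_corners_rev l w h : (l <= n.+1)%N -> bruhat_cell w h ->
  (forall p, (p <= l)%N -> \det (corner p h) != 0) ->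
  forall a : 'I_n.+1, (a < l)%N -> w a = rev_ord a.
Proof.
move=> ln hw dets a al.
suff H k : forall a : 'I_n.+1, (a < k)%N -> (a < l)%N -> w a = rev_ord a.
  exact: (H a.+1).
elim: k => // k IHk {al}a; rewrite ltnS => ak al.
have wa : (n.+1 - a.+1 <= w a)%N.
  by apply: (bruhat_corner (leq_trans al ln) hw (dets _ al)).
apply: val_inj => /=; apply/eqP; rewrite eqn_leq wa andbT leqNgt.
apply/negP => lt_wa.
have rlt : (rev_ord (w a) < a)%N by move: lt_wa => /=; have := ltn_ord (w a); lia.
have := IHk (rev_ord (w a)) (leq_trans rlt ak) (ltn_trans rlt al).
by rewrite rev_ordK => /perm_inj e; move: rlt; rewrite e ltnn.
Qed.

(** With b = b1^-1 b2^-1, the matrix h - c has the rank of M = d - c b. Below the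
    diagonal M agrees with d, so its submatrix on the rows w a and the columns a, for
    a < w a, is triangular in the order of the columns, with nonzero entries of d on
    the diagonal. *)
Lemma excedances_le_rank w h c :
  bruhat_cell w h -> (#|[set a : 'I_n.+1 | (a < w a)%N]%SET| <= \rank (h - c%:M)%R)%N.
Proof.
move=> [b1 [d [b2 [B1 dw B2 ->]]]]; set E := [set _ | _]%SET.
have u1 : b1 \in unitmx by case: B1 => /SL_unit.
have u2 : b2 \in unitmx by case: B2 => /SL_unit.
have [_] := borel_mul (borel_inv B1) (borel_inv B2).
move eqb: (invmx b1 *m invmx b2) => b bU.
pose M := d - c *: b.
have ME : M = invmx b1 *m (b1 *m d *m b2 - c%:M) *m invmx b2.
  rewrite mulmxBr mulmxBl -!mulmxA mulKmx // mulmxV // mulmx1 mul_scalar_mx.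
  by rewrite -scalemxAr eqb.
apply: (@leq_trans (\rank M)); last first.
  by rewrite ME (leq_trans (mxrankM_maxl _ _)) // mxrankM_maxr.
pose e := @enum_val _ (mem E).
pose T := mxsub (w \o e) e M.
have TM : (\rank T <= \rank M)%N.
  have -> : T = rowsub (w \o e) (M *m colsub e 1%:M).
    by rewrite mulmx_colsub mulmx1 -mxsub_comp.
  by rewrite (leq_trans (mxrankS (rowsub_sub _ _))) // mxrankM_maxl.
apply: leq_trans TM; rewrite row_leq_rank -kermx_eq0; apply/rowV0P => v /sub_kermxP vT.
have exc a : (e a < w (e a))%N by have := enum_valP a; rewrite inE.
have Tdiag a : T a a != 0.
  rewrite !mxE /= bU ?mulr0 ?subr0 ?exc //; exact: weyl_repr_neq0.
have Toff a a' : (e a' <= e a)%N -> a != a' -> T a a' = 0.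
  move=> aa' ne; rewrite !mxE /= bU ?(leq_ltn_trans aa' (exc a)) // mulr0 subr0.
  apply/eqP; have [_ dE] := dw; rewrite -[_ == 0]negbK dE.
  by rewrite (inj_eq (@perm_inj _ w)) (inj_eq enum_val_inj).
suff H k : forall a, (e a < k)%N -> v 0 a = 0.
  by apply/rowP => a; rewrite mxE (H (e a).+1).
elim: k => // k IHk a ak.
have := congr1 (fun x : 'rV_ _ => x 0 a) vT.
rewrite !mxE (bigD1 a) //= big1 => [|a' a'a].
  by rewrite addr0 => /eqP; rewrite mulf_eq0 (negPf (Tdiag a)) orbF => /eqP.
have [aa'|a'lt] := leqP (e a) (e a'); first by rewrite Toff ?mulr0.
by rewrite IHk ?mul0r // (leq_trans a'lt).
Qed.

End CellDetection.

(** * The involutions m_l and the longest element *)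

Section Involutions.
Variable m : nat.
Implicit Types (w : 'S_m) (a : 'I_m).

Lemma prod_tperm_rev (s : seq 'I_m) a :
  uniq s -> all (fun i : 'I_m => (i < m./2)%N) s ->
  (\prod_(i <- s) tperm i (rev_ord i))%g a =
  if (a \in s) || (rev_ord a \in s) then rev_ord a else a.
Proof.
elim: s a => [|i s IHs] a /=; first by rewrite big_nil perm1.
move=> /andP[nis us] /andP[ilt slt]; rewrite big_cons permM IHs // !inE.
have half (j : 'I_m) : (j < m./2)%N -> (m./2 <= rev_ord j)%N.
  move=> jm /=; rewrite leq_subRL // -[X in (_ <= X)%N]odd_double_half -addnn addnA.
  by rewrite leq_add2r (leq_trans jm) ?leq_addl.
have ris : rev_ord i \notin s.
  apply/negP => /(allP slt); rewrite ltnNge => /negP; apply; exact: half.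
case: tpermP => [->|->|ai aj].
- by rewrite eqxx /= rev_ordK (negPf nis) (negPf ris).
- by rewrite rev_ordK eqxx orbT /= (negPf nis) (negPf ris).
- have -> : (a == i) = false by apply/eqP.
  have -> // : (rev_ord a == i) = false.
  by apply/eqP => e; apply: aj; rewrite -e rev_ordK.
Qed.

Lemma m_permE l a : (l <= m./2)%N ->
  m_perm m l a = if (a < l)%N || (rev_ord a < l)%N then rev_ord a else a.
Proof.
move=> lm; rewrite /m_perm -big_filter prod_tperm_rev.
- by rewrite !mem_filter !mem_index_enum !andbT.
- by rewrite filter_uniq // index_enum_uniq.
- by apply/allP => i; rewrite mem_filter => /andP[il _]; apply: leq_trans lm.
Qed.

(** The first two conditions make w permute the remaining middle indices, and the last
    one says that it never increases them, hence fixes each of them. *)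
Lemma eq_m_perm l w : (l <= m./2)%N ->
  (forall a, (a < l)%N -> w a = rev_ord a) ->
  (forall a, (a < l)%N -> w^-1%g a = rev_ord a) ->
  (forall a, (l <= a)%N -> (l <= rev_ord a)%N -> (l <= w a)%N ->
     (l <= rev_ord (w a))%N -> (w a <= a)%N) ->
  w = m_perm m l.
Proof.
move=> lm wl wVl wmid.
have wVl' a : (a < l)%N -> w (rev_ord a) = a.
  by move=> al; rewrite -wVl ?permKV.
have mid a : (l <= a)%N -> (l <= rev_ord a)%N -> (l <= w a)%N && (l <= rev_ord (w a))%N.
  move=> la lra; apply/andP; split; rewrite leqNgt; apply/negP => H.
    have e : rev_ord (w a) = a by apply: (@perm_inj _ w); rewrite wVl'.
    by have := congr1 (fun b => rev_ord b : nat) e; rewrite rev_ordK => e'; lia.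
  have e : rev_ord (w a) = a.
    by have := wl _ H; rewrite rev_ordK => /perm_inj.
  by move: H; rewrite e; lia.
have fixw k : forall a, (a < k)%N -> (l <= a)%N -> (l <= rev_ord a)%N -> w a = a.
  elim: k => // k IHk a; rewrite ltnS => ak la lra.
  have /andP[lwa lrwa] := mid a la lra.
  have := wmid a la lra lwa lrwa; rewrite leq_eqVlt => /orP[/eqP/val_inj//|lt].
  have /perm_inj e := IHk (w a) (leq_trans lt ak) lwa lrwa.
  by move: lt; rewrite e ltnn.
apply/permP => a; rewrite m_permE //.
have [al|la] /= := ltnP a l; first exact: wl.
have [ral|lra] := ltnP (rev_ord a) l; first by rewrite -[a in LHS]rev_ordK wVl'.
exact: fixw (a.+1) _ _ _ _.
Qed.

(** The l indices a < l are excedances, as l <= m/2; so the bound leaves no other. *)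
Lemma excedances_below l w : (l <= m./2)%N ->
  (forall a, (a < l)%N -> w a = rev_ord a) ->
  (#|[set a : 'I_m | (a < w a)%N]%SET| <= l)%N ->
  forall a, (l <= a)%N -> (w a <= a)%N.
Proof.
move=> lm wl card a la; rewrite leqNgt; apply/negP => aw.
have lm' : (l <= m)%N by lia.
have : (#|(a |: [set widen_ord lm' i | i in 'I_l])%SET| <= l)%N.
  apply: leq_trans card; apply: subset_leq_card; apply/fintype.subsetP => b.
  rewrite !inE => /orP[/eqP->//|/imsetP[i _ ->]].
  by rewrite wl //=; have := ltn_ord i; lia.
rewrite cardsU1 card_imset ?card_ord; last first.
  by move=> i j /(congr1 val) /= /val_inj.
case: imsetP => [[i _ ai]|_] /=; last by rewrite add1n ltnn.
by move: la; rewrite ai /= leqNgt ltn_ord.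
Qed.

(** The order reversal inverts every pair, so a permutation of maximal length inverts
    every pair too, and is decreasing. *)
Lemma w0E : w0 m = m_perm m m./2.
Proof.
set r := m_perm m m./2.
have rE a : r a = rev_ord a.
  rewrite m_permE //; case: ifP => // H; apply: val_inj => /=.
  by move: H => /=; have := ltn_ord a; lia.
have rlen : perm_length r = #|[set ij : 'I_m * 'I_m | (ij.1 < ij.2)%N]%SET|.
  apply: eq_card => -[i j]; rewrite !inE /= !rE.
  by case: ltnP => //= ij; have := ltn_ord j; lia.
rewrite /w0; case: arg_maxnP => // w _ /(_ r isT) /=; rewrite rlen => wmax.
have inv (i j : 'I_m) : (i < j)%N -> (w j < w i)%N.
  move=> ij; pose Q := [set ij : 'I_m * 'I_m | (ij.1 < ij.2)%N]%SET.
  pose P := [set ij : 'I_m * 'I_m | (ij.1 < ij.2)%N && (w ij.2 < w ij.1)%N]%SET.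
  have QP : (#|Q| <= #|P|)%N := wmax.
  have PQ : P \subset Q.
    by apply/fintype.subsetP => x; rewrite !inE => /andP[].
  have /eqP PE : P == Q by rewrite eqEcard PQ.
  have : (i, j) \in P by rewrite PE inE.
  by rewrite inE => /andP[].
(* w is decreasing: rev_ord a values lie below w a, and a values above. *)
have le k : forall a : 'I_m, (rev_ord a < k)%N -> (rev_ord a <= w a)%N.
  elim: k => // k IHk a ak.
  have [a0|a0] := posnP (rev_ord a); first by rewrite a0.
  have am : (a.+1 < m)%N by move: a0 => /=; lia.
  have /(IHk (Ordinal am)) /= : (rev_ord (Ordinal am) < k)%N.
    by move: ak a0 => /=; lia.
  by have := inv a (Ordinal am) (leqnn _) => /=; lia.
have le' k : forall a : 'I_m, (a < k)%N -> (w a <= rev_ord a)%N.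
  elim: k => // k IHk a ak.
  have [a0|a0] := posnP a; first by rewrite /= a0; have := ltn_ord (w a); lia.
  have am : (a.-1 < m)%N by have := ltn_ord a; lia.
  have /(IHk (Ordinal am)) /= : (Ordinal am < k)%N by move: ak a0 => /=; lia.
  have := inv (Ordinal am) a; rewrite /= prednK // => /(_ (leqnn _)).
  by have := ltn_ord a; lia.
apply/permP => a; rewrite rE; apply: val_inj; apply/eqP.
by rewrite eqn_leq (le' a.+1) ?(le (rev_ord a).+1).
Qed.

End Involutions.

(** * Irreducibility of a conjugacy class *)

Local Open Scope classical_set_scope.

Section RegularAlongLine.
Variables (k : fieldType) (D : {poly k}).

(** Here D is the determinant along a line of matrices, the denominator that entries
    of inverse matrices introduce. *)
Definition regular_away (f : k -> k) :=
  exists e (q : {poly k}), forall t, D.[t] != 0 -> q.[t] = D.[t] ^+ e * f t.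

Lemma regular_away_cst c : regular_away (fun=> c).
Proof. by exists 0%N, c%:P => t _; rewrite hornerC mul1r. Qed.

Lemma regular_away_add f f' :
  regular_away f -> regular_away f' -> regular_away (fun t => f t + f' t).
Proof.
move=> [e [q qE]] [e' [q' qE']]; exists (e + e')%N, (D ^+ e' * q + D ^+ e * q').
by move=> t Dt; rewrite hornerD !hornerM !horner_exp qE // qE' // exprD; ring.
Qed.

Lemma regular_away_mul f f' :
  regular_away f -> regular_away f' -> regular_away (fun t => f t * f' t).
Proof.
move=> [e [q qE]] [e' [q' qE']]; exists (e + e')%N, (q * q').
by move=> t Dt; rewrite hornerM qE // qE' // exprD; ring.
Qed.

Lemma regular_away_meval m (A : 'I_m -> {poly k}) (p : {mpoly k[m]}) :
  regular_away (fun t => p.@[fun i => (A i).[t] / D.[t]]).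
Proof.
elim/mpolyind: p => [|c u p _ _ IHp].
  have -> : (fun t => (0 : {mpoly k[m]}).@[fun i => (A i).[t] / D.[t]]) = fun=> 0.
    by apply: funext => t; rewrite meval0.
  exact: regular_away_cst.
have -> : (fun t => (c *: 'X_[u] + p).@[fun i => (A i).[t] / D.[t]]) =
  (fun t => c * \prod_i ((A i).[t] / D.[t]) ^+ u i +
            p.@[fun i => (A i).[t] / D.[t]]).
  by apply: funext => t; rewrite mevalD mevalZ mevalX.
apply: regular_away_add => //; apply: regular_away_mul.
  exact: regular_away_cst.
elim: (index_enum _) => [|i s IHs].
  rewrite (_ : (fun t => _) = fun=> 1); first exact: regular_away_cst.
  by apply: funext => t; rewrite big_nil.
rewrite (_ : (fun t => _) = fun t => ((A i).[t] / D.[t]) ^+ u i *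
    \prod_(j <- s) ((A j).[t] / D.[t]) ^+ u j); last first.
  by apply: funext => t; rewrite big_cons.
apply: regular_away_mul => //; exists (u i), (A i ^+ u i) => t Dt.
by rewrite horner_exp expr_div_n mulrCA divff ?mulr1 // expf_neq0.
Qed.

End RegularAlongLine.

Section Genericity.
Variables (k : closedFieldType) (n : nat).
Implicit Types (g h x y : 'M[k]_n.+1) (q : {mpoly k[n.+1 * n.+1]}).

(** Over an algebraically closed field x has a multiple of determinant 1, and scaling
    does not change the conjugate. *)
Lemma SL_class_of_unit g x : x \in unitmx -> SL_class_of g (x *m g *m invmx x).
Proof.
move=> xu; have d0 : \det x != 0 by rewrite -unitfE -unitmxE.
have [c] : exists c, root ('X^(n.+1) - (\det x)%:P) c.
  by apply/closed_rootP; rewrite size_XnsubC.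
rewrite rootE !hornerE subr_eq0 => /eqP cE.
have c0 : c != 0 by apply: contraNneq d0 => c0; rewrite -cE c0 expr0n.
have uc : c^-1 *: x \in unitmx by rewrite unitmxZ // unitfE invr_eq0.
exists (c^-1 *: x); first by rewrite /SL /= detZ exprVn cE mulVf.
by rewrite invmxZ // invrK -!scalemxAl -scalemxAr scalerA mulVf // scale1r.
Qed.

Lemma SL_class_of_trans g h : SL_class_of g h -> SL_class_of h = SL_class_of g.
Proof.
move=> [x xS <-]; have xu := SL_unit xS.
apply/seteqP; split=> _ [y yS <-]; have yu := SL_unit yS.
  have yxu : y *m x \in unitmx by rewrite unitmx_mul yu.
  exists (y *m x); first exact: SL_mul.
  apply: (can_inj (mulmxK yxu)); rewrite /= mulmxKV // !mulmxA mulmxKV //.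
  by rewrite mulmxKV.
have yxu : y *m invmx x \in unitmx by rewrite unitmx_mul yu unitmx_inv.
exists (y *m invmx x); first by apply: SL_mul => //; apply: SL_inv.
apply: (can_inj (mulmxK yu)); rewrite /= mulmxKV // !mulmxA mulmxKV //.
have yxK : invmx (y *m invmx x) *m y = x.
  apply: (can_inj (mulKmx yxu)); rewrite !mulmxA mulmxV // mul1mx.
  by rewrite mulmxKV.
by rewrite -[LHS]mulmxA yxK mulmxKV.
Qed.

(** Join the conjugating matrices x0 and x1 by a line x_t. Up to a power of det x_t, the
    values of p and q at x_t g x_t^-1 are polynomials in t, the first nonzero at t = 0,
    the second at t = 1; their product with det x_t has a nonroot, as k is infinite. *)
Lemma SL_class_irreducible g (p q : {mpoly k[n.+1 * n.+1]}) :
  (exists2 y, SL_class_of g y & entry_eval p y != 0) ->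
  (exists2 y, SL_class_of g y & entry_eval q y != 0) ->
  exists2 y, SL_class_of g y & (entry_eval p y != 0) && (entry_eval q y != 0).
Proof.
move=> [_ [x0 x0S <-] p0] [_ [x1 x1S <-] q1].
pose X : 'M[{poly k}]_n.+1 := map_mx polyC x0 + 'X *: map_mx polyC (x1 - x0).
pose Q := X *m map_mx polyC g *m \adj X; pose D := \det X.
pose ev t := map_mx (horner_eval t) : 'M[{poly k}]_n.+1 -> 'M[k]_n.+1.
have evC t h : ev t (map_mx polyC h) = h.
  by apply/matrixP => i j; rewrite !mxE horner_evalE hornerC.
have evX t : ev t X = x0 + t *: (x1 - x0).
  by rewrite /ev map_mxD map_mxZ /= horner_evalE hornerX -!/(ev t _) !evC.
have evD t : D.[t] = \det (ev t X) by rewrite -horner_evalE -det_map_mx.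
have evQ t : ev t Q = ev t X *m g *m \adj (ev t X).
  by rewrite /ev !map_mxM /= map_mx_adj -!/(ev t _) evC.
have conjE t r : D.[t] != 0 ->
  entry_eval r (ev t X *m g *m invmx (ev t X)) =
  r.@[fun i => (mxvec Q 0 i).[t] / D.[t]].
  move=> Dt; apply: meval_eq => i.
  have -> : ev t X *m g *m invmx (ev t X) = (D.[t])^-1 *: ev t Q.
    by rewrite evQ /invmx unitmxE unitfE -evD Dt -scalemxAr.
  by rewrite linearZ /= mxE /ev -map_mxvec mxE mulrC.
have [e [P PE]] := regular_away_meval D (fun i => mxvec Q 0 i) p.
have [e' [P' PE']] := regular_away_meval D (fun i => mxvec Q 0 i) q.
have ev0 : ev 0 X = x0 by rewrite evX scale0r addr0.
have ev1 : ev 1 X = x1 by rewrite evX scale1r addrC subrK.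
have D0 : D.[0] != 0 by rewrite evD ev0 [\det _]x0S oner_neq0.
have D1 : D.[1] != 0 by rewrite evD ev1 [\det _]x1S oner_neq0.
have nz (R : {poly k}) t : R.[t] != 0 -> R != 0.
  by apply: contraNneq => ->; rewrite horner0.
have : P * P' * D != 0.
  rewrite !mulf_neq0 //; last exact: nz D0.
    by apply: (nz _ 0); rewrite PE // -conjE // ev0 mulf_neq0 ?expf_neq0.
  by apply: (nz _ 1); rewrite PE' // -conjE // ev1 mulf_neq0 ?expf_neq0.
move=> /closed_nonrootP[t]; rewrite rootE !hornerM !mulf_eq0 !negb_or.
move=> /andP[/andP[Pt P't] Dt].
exists (ev t X *m g *m invmx (ev t X)).
  by apply: SL_class_of_unit; rewrite unitmxE unitfE -evD.
rewrite !conjE //; move: Pt P't; rewrite PE // PE' // !mulf_eq0 !negb_or.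
by move=> /andP[_ ->] /andP[_ ->].
Qed.

Lemma SL_class_prod_neq0 g (s : seq {mpoly k[n.+1 * n.+1]}) :
  (forall q, q \in s -> exists2 y, SL_class_of g y & entry_eval q y != 0) ->
  exists2 y, SL_class_of g y & entry_eval (\prod_(q <- s) q) y != 0.
Proof.
elim: s => [|q s IHs] qs.
  exists (1%:M *m g *m invmx 1%:M).
    by apply: SL_class_of_unit; rewrite unitmx1.
  by rewrite big_nil /entry_eval meval1 oner_neq0.
have [||y gy /andP[qy sy]] := @SL_class_irreducible g q (\prod_(q <- s) q).
- by apply: qs; rewrite mem_head.
- by apply: IHs => r rs; apply: qs; rewrite inE rs orbT.
by exists y => //; rewrite big_cons /entry_eval mevalM mulf_neq0.
Qed.

(** * The generic cell of a conjugacy class *)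

Definition generic_mx : 'M[{mpoly k[n.+1 * n.+1]}]_n.+1 :=
  \matrix_(i, j) 'X_(mxvec_index i j).

Lemma entry_eval_det r (f : 'I_r -> 'I_n.+1) (f' : 'I_r -> 'I_n.+1)
    (M : 'M[{mpoly k[n.+1 * n.+1]}]_n.+1) h :
  entry_eval (\det (mxsub f f' M)) h =
  \det (mxsub f f' (map_mx (fun q => entry_eval q h) M)).
Proof. by rewrite /entry_eval -map_mxsub det_map_mx. Qed.

Lemma entry_eval_generic h : map_mx (fun q => entry_eval q h) generic_mx = h.
Proof. by apply/matrixP => i j; rewrite !mxE /entry_eval mevalXU mxvecE. Qed.

Lemma entry_eval_corner p h :
  entry_eval (\det (corner p generic_mx)) h = \det (corner p h).
Proof. by rewrite entry_eval_det entry_eval_generic. Qed.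

(** On SL the inverse is the adjugate, whose entries are polynomials. *)
Lemma entry_eval_corner_inv p h : SL h ->
  entry_eval (\det (corner p (\adj generic_mx))) h = \det (corner p (invmx h)).
Proof.
move=> hS; have hu := SL_unit hS; rewrite entry_eval_det.
rewrite /entry_eval map_mx_adj -/(entry_eval _ _) [map_mx _ _]entry_eval_generic.
by rewrite /invmx hu hS invr1 scale1r.
Qed.

Lemma r_of_attained g : exists c, \rank (g - c%:M) = r_of g.
Proof. by rewrite /r_of; case: ex_minnP => r /asboolP. Qed.

Lemma r_of_le g c : (r_of g <= \rank (g - c%:M)%R)%N.
Proof.
by rewrite /r_of; case: ex_minnP => r _; apply; apply/asboolP; exists c.
Qed.

(** For c <> 0, g (g^-1 - c) is a multiple of g - c^-1, and for c = 0 the rank is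
    maximal. *)
Lemma rank_shift_inv g l : g \in unitmx -> (l <= n.+1)%N ->
  (forall c, (l <= \rank (g - c%:M)%R)%N) ->
  forall c, (l <= \rank (invmx g - c%:M)%R)%N.
Proof.
move=> gu ln rg c; have [->|c0] := eqVneq c 0.
  by rewrite raddf0 subr0 mxrank_unit // unitmx_inv.
have E : g - c^-1%:M = - c^-1 *: (g *m (invmx g - c%:M)).
  rewrite mulmxBr mulmxV // mul_mx_scalar scalerBr scaleNr scalemx1 scalerA.
  by rewrite mulNr mulVf // scaleN1r opprK addrC.
apply: leq_trans (rg c^-1) _; rewrite E.
by rewrite (leq_trans (mxrank_scale _ _)) // mxrankM_maxr.
Qed.

Definition generic_minors l : seq {mpoly k[n.+1 * n.+1]} :=
  [seq \det (corner p generic_mx) | p <- iota 0 l.+1] ++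
  [seq \det (corner p (\adj generic_mx)) | p <- iota 0 l.+1].

Lemma SL_class_SL g y : SL g -> SL_class_of g y -> SL y.
Proof. by move=> gS [x xS <-]; apply: SL_mul; [apply: SL_mul | apply: SL_inv]. Qed.

Lemma generic_minors_neq0 g : SL g ->
  exists2 y, SL_class_of g y &
    entry_eval (\prod_(q <- generic_minors (l_of g)) q) y != 0.
Proof.
move=> gS; have gu := SL_unit gS.
have lhalf : ((l_of g).*2 <= n.+1)%N.
  by rewrite /l_of; lia.
have lr c : (l_of g <= \rank (g - c%:M)%R)%N.
  by rewrite (leq_trans (geq_minl _ _)) // r_of_le.
have ln : (l_of g <= n.+1)%N by lia.
apply: SL_class_prod_neq0 => q; rewrite mem_cat => /orP[] /mapP[p].
  rewrite mem_iota /= add0n ltnS => pl ->.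
  have [||x xu cx] := @exists_corner_unit n p k g; first by lia.
    by move=> c; apply: leq_trans pl (lr c).
  exists (x *m g *m invmx x); first exact: SL_class_of_unit.
  by rewrite entry_eval_corner cx det1 oner_neq0.
rewrite mem_iota /= add0n ltnS => pl ->.
have [||x xu cx] := @exists_corner_unit n p k (invmx g); first by lia.
  by move=> c; apply: leq_trans pl _; apply: rank_shift_inv.
have gx : SL_class_of g (x *m g *m invmx x) by apply: SL_class_of_unit.
exists (x *m g *m invmx x) => //.
rewrite entry_eval_corner_inv; last exact: SL_class_SL gx.
have yu : x *m g *m invmx x \in unitmx by rewrite !unitmx_mul xu gu unitmx_inv.
have yV : invmx (x *m g *m invmx x) = x *m invmx g *m invmx x.
  apply: (can_inj (mulKmx yu)); rewrite mulmxV // !mulmxA mulmxKV // mulmxK //.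
  by rewrite mulmxV.
by rewrite yV cx det1 oner_neq0.
Qed.

Lemma generic_minors_cell g y : SL g -> SL_class_of g y ->
  entry_eval (\prod_(q <- generic_minors (l_of g)) q) y != 0 ->
  bruhat_cell (m_perm n.+1 (l_of g)) y.
Proof.
move=> gS gy; have yS := SL_class_SL gS gy.
rewrite /entry_eval rmorph_prod /= prodf_seq_neq0 => /allP nz.
have c1 p : (p <= l_of g)%N -> \det (corner p y) != 0.
  move=> pl; rewrite -entry_eval_corner; apply: nz.
  by rewrite mem_cat; apply/orP; left; apply/mapP; exists p; rewrite ?mem_iota.
have c2 p : (p <= l_of g)%N -> \det (corner p (invmx y)) != 0.
  move=> pl; rewrite -entry_eval_corner_inv //; apply: nz.
  by rewrite mem_cat; apply/orP; right; apply/mapP; exists p; rewrite ?mem_iota.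
have [w wy] := SL_bruhat_cell yS.
have lh : (l_of g <= n.+1./2)%N by apply: geq_minr.
have ln : (l_of g <= n.+1)%N by lia.
have w1 := bruhat_corners_rev ln wy c1.
have w2 := bruhat_corners_rev ln (bruhat_cell_inv wy) c2.
rewrite -(eq_m_perm lh w1 w2) // => a la lra lwa lrwa.
have [rl|hr] := leqP (r_of g) n.+1./2; last first.
  have lE : l_of g = n.+1./2 by apply/minn_idPr/ltnW.
  have hl : (n.+1 <= (l_of g).*2.+1)%N by rewrite lE; lia.
  have := ltn_ord a; have := ltn_ord (w a).
  by move: lra lrwa => /=; lia.
have lE : l_of g = r_of g by apply/minn_idPl.
apply: (excedances_below lh w1) => //.
have [c rc] := r_of_attained g.
apply: leq_trans (excedances_le_rank c wy) _; rewrite lE -rc.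
have [x xS <-] := gy; have xu := SL_unit xS.
have -> : x *m g *m invmx x - c%:M = x *m (g - c%:M) *m invmx x.
  by rewrite mulmxBr mulmxBl mul_mx_scalar -scalemxAl mulmxV // scalemx1.
by rewrite (leq_trans (mxrankM_maxl _ _)) // mxrankM_maxr.
Qed.

(** Both halves use the locus where the generic minors do not vanish: it is dense in
    the class and contained in one cell. *)
Lemma is_m_of_SL_class g : SL g ->
  is_m_of_class (SL_class_of g) (m_perm n.+1 (l_of g)).
Proof.
move=> gS; have [y0 gy0 H0] := generic_minors_neq0 gS.
set H := \prod_(q <- _) q in H0.
split=> [|w [_ dense_w]].
  split=> [y []//|y gy Z [P ->] subZ p Pp]; apply/eqP; apply: contraT => py.
  have [||y' gy' /andP[py' Hy']] := @SL_class_irreducible g p H.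
  - by exists y.
  - by exists y0.
  have y'cell := generic_minors_cell gS gy' Hy'.
  by have /eqP := subZ y' (conj gy' y'cell) p Pp; rewrite (negPf py').
apply: contrapT => ww; have := dense_w y0 gy0.
move=> /(_ [set y | entry_eval H y = 0]) /=.
have closedH : zariski_closed [set y | entry_eval H y = 0].
  exists [set H]; apply/seteqP; split=> y /=; first by move=> Hy p ->.
  by move=> /(_ H erefl).
move=> /(_ closedH) h0; case/eqP: H0; apply: h0 => y [gy wy] /=.
apply/eqP; apply: contraT => Hy; case: ww.
exact: bruhat_cell_inj (generic_minors_cell gS gy Hy) wy.
Qed.

End Genericity.

Theorem corollary4p3 (k : closedFieldType) (n : nat) (hn : (1 <= n)%N)
  (C : set 'M[k]_n.+1) (hC : SL_conjugacy_class C)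
  (g : 'M[k]_n.+1) (hg : C g) :
  exists mC : 'S_n.+1,
    [/\ is_m_of_class C mC,
        mC = m_perm n.+1 (l_of g),
        (n.+1./2 <= r_of g)%N -> mC = w0 n.+1
      & (r_of g < n.+1./2)%N -> mC = m_perm n.+1 (r_of g)].
Proof.
have [g0 g0S CE] := hC; rewrite CE in hg *.
exists (m_perm n.+1 (l_of g)); split => //.
- rewrite -(SL_class_of_trans hg); apply: is_m_of_SL_class.
  exact: SL_class_SL g0S hg.
- by move=> hr; rewrite w0E /l_of (minn_idPr hr).
- by move=> rh; rewrite /l_of (minn_idPl (ltnW rh)).
Qed.
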